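(* (Data processing.) Let $Q_X$ be a probability measure on $\mathcal{X}$, let $Q_{Y_j|X}$ be a random transformation from $\mathcal{X}$ to $\mathcal{Y}_j$ and $c_j\in(0,\infty)$ for $j=1,\dots,m$, and let $d\in\mathbb{R}$. Suppose that $$D(P_X\|Q_X)+d\ge\sum_{j=1}^mc_jD(P_{Y_j}\|Q_{Y_j})\qquad\text{for all }P_X\ll Q_X.$$ Then for any random transformations $Q_{Z_j|Y_j}$ from $\mathcal{Y}_j$ to $\mathcal{Z}_j$, $j=1,\dots,m$, $$D(P_X\|Q_X)+d\ge\sum_{j=1}^mc_jD(P_{Z_j}\|Q_{Z_j})\qquad\text{for all }P_X\ll Q_X,$$ where $Q_{Z_j|X}$ is the composition of $Q_{Y_j|X}$ followed by $Q_{Z_j|Y_j}$, and $P_{Z_j}$, $Q_{Z_j}$ are the outputs of $Q_{Z_j|X}$ under inputs $P_X$, $Q_X$.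
   Context: All spaces are measurable spaces and random transformations are Markov kernels. $P_X$ ranges over probability measures on $\mathcal{X}$; $P_{Y_j}$ and $Q_{Y_j}$ are the output distributions of $Q_{Y_j|X}$ under inputs $P_X$ and $Q_X$ respectively. $D(P\|Q):=\mathbb{E}_P[\log\frac{\mathrm{d}P}{\mathrm{d}Q}]$ if $P\ll Q$, and $+\infty$ otherwise. *)

(* Defs.v *)
From HB Require Import structures.
From mathcomp Require Import all_boot all_order all_algebra.
From mathcomp Require Import all_classical all_reals all_analysis.

Set Implicit Arguments.
Unset Strict Implicit.
Unset Printing Implicit Defensive.

Import Order.TTheory GRing.Theory Num.Theory.
Import numFieldNormedType.Exports.

Local Open Scope classical_set_scope.
Local Open Scope ring_scope.
Local Open Scope ereal_scope.
Local Open Scope charge_scope.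

(* The logarithm is natural. The derivative 'd P '/d Q is determined up to a
   Q-null set, hence up to a P-null set since P `<< Q, and it is positive
   P-almost everywhere; so neither the choice of a version nor the convention
   lne r = -oo for r <= 0 affects the integral. The negative part of the
   integrand has a P-integral of at most 1/e, so the integral is never of the
   form +oo - +oo. *)
Definition kl_divergence d (T : measurableType d) (R : realType)
    (P Q : probability T R) : \bar R :=
  if `[< P `<< Q >]
  then \int[P]_x lne (('d (charge_of_finite_measure P) '/d Q) x)
  else +oo.

Section kernel_output.
Context d d' (X : measurableType d) (Y : measurableType d') (R : realType).
Variables (P : probability X R) (K : R.-pker X ~> Y).

Definition kernel_output (A : set Y) : \bar R := \int[P]_x K x A.

Let kernel_output0 : kernel_output set0 = 0.
Proof. by apply: integral0_eq => x _; rewrite measure0. Qed.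

Let kernel_output_ge0 A : 0 <= kernel_output A.
Proof. by apply: integral_ge0 => x _; exact: measure_ge0. Qed.

Let kernel_output_sigma_additive : semi_sigma_additive kernel_output.
Proof.
move=> F mF tF mUF; rewrite [X in _ --> X](_ : _ =
    \int[P]_x (\sum_(n <oo) K x (F n))); last first.
  apply: eq_integral => x _.
  by apply/esym/cvg_lim => //; exact: measure_semi_sigma_additive.
rewrite integral_nneseries//; last by move=> n; exact: measurable_kernel.
by apply: is_cvg_nneseries => n _ _; exact: kernel_output_ge0.
Qed.

HB.instance Definition _ := isMeasure.Build _ _ _ kernel_output
  kernel_output0 kernel_output_ge0 kernel_output_sigma_additive.

Let kernel_output_setT : kernel_output [set: Y] = 1.
Proof.
rewrite /kernel_output (eq_integral (cst 1)) => [|x _]; last exact: prob_kernel.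
by rewrite integral_cst// mul1e; exact: probability_setT.
Qed.

HB.instance Definition _ :=
  Measure_isProbability.Build _ _ _ kernel_output kernel_output_setT.

End kernel_output.

(* The composition of kernels is the library's [mkcomp_noparam], which is only
   equipped with a subprobability kernel structure. *)
Section probability_mkcomp_noparam.
Context d0 d1 d2 (X : measurableType d0) (Y : measurableType d1)
  (Z : measurableType d2) (R : realType).
Variables (K : R.-pker X ~> Y) (L : R.-pker Y ~> Z).

Let mkcomp_noparam_setT x : mkcomp_noparam K L x [set: Z] = 1.
Proof.
rewrite /mkcomp_noparam/= /kcomp_noparam.
rewrite (eq_integral (cst 1)) => [|y _]; last exact: prob_kernel.
by rewrite integral_cst// mul1e; exact: prob_kernel.
Qed.

HB.instance Definition _ := isProbabilityKernel.Build _ _ _ _ R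
  (mkcomp_noparam K L) mkcomp_noparam_setT.

End probability_mkcomp_noparam.

(* Main.v *)
(* Data processing for a single kernel K, D(PK || QK) <= D(P || Q), applied to
   each Q_(Z_j|Y_j). Let f = dP/dQ and g = d(PK)/d(QK). Integrating the
   pointwise inequality f(x) ln (g(y) / f(x)) <= g(y) - f(x) against
   Q(dx) K(x, dy) gives E_PK[ln g] - E_P[ln f] <= 1 - 1 = 0. To avoid
   integrability questions, the logarithms are split into positive and negative
   parts; the negative parts have integral at most 1, so they cancel. *)
Require Import Defs.
From HB Require Import structures.
From mathcomp Require Import all_boot all_order all_algebra.
From mathcomp Require Import all_classical all_reals all_analysis.
From mathcomp Require Import measurable_realfun giry ring lra.

Set Implicit Arguments.
Unset Strict Implicit.
Unset Printing Implicit Defensive.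

Import Order.TTheory GRing.Theory Num.Theory.

Local Open Scope classical_set_scope.
Local Open Scope ring_scope.
Local Open Scope ereal_scope.
Local Open Scope charge_scope.

(** * Logarithm inequalities on the extended reals *)

Lemma measurable_lne (R : realType) : measurable_fun setT (@lne R).
Proof.
rewrite (_ : @lne R = fun x =>
    if x <= 0 then -oo else if +oo <= x then +oo else (ln (fine x))%:E).
  apply: measurable_fun_ifT => //; first exact: measurable_fun_lee.
  apply: measurable_fun_ifT => //; first exact: measurable_fun_lee.
  apply/measurable_EFinP; apply: measurableT_comp; first exact: measurable_ln.
  exact: fine_measurable.
by apply/funext => -[r| |]; rewrite ?leye_eq ?leNye.
Qed.

(* This is [a * ln (b / a) <= b - a], with the logarithms split into positive
   and negative parts and moved so that all terms are nonnegative. *)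
Lemma gibbs_pointwise (R : realType) (a b : \bar R) :
  a \is a fin_num -> b \is a fin_num -> 0 <= a -> 0 <= b ->
  a * (@lne R)^\+ b + a + a * (@lne R)^\- a <=
  a * (@lne R)^\+ a + b + a * (@lne R)^\- b.
Proof.
case: a b => [a| |] // [b| |] // _ _; rewrite !lee_fin => a0 b0.
rewrite !funeposE !funenegE.
(* At [a = 0] the product with the infinite negative part of [lne 0] is 0, so only [0 <= b]
   remains. *)
move: a0; rewrite le_eqVlt => /predU1P[<-|a0].
  by rewrite !mul0e !adde0 !add0e lee_fin.
(* For [b = 0 < a] the negative part of [lne b] makes the right side [+oo]. *)
move: b0; rewrite le_eqVlt => /predU1P[<-|b0].
  rewrite [lne 0]le0_lneNy//= maxNye /=.
  rewrite (_ : maxe +oo 0 = +oo); last by rewrite maxye.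
  rewrite gt0_muley ?lte_fin// addey ?leey//.
  by rewrite leNgt a0 -EFin_max -EFinM -EFinD.
rewrite !lne_EFin// -!EFinN -!EFin_max -!EFinM -!EFinD lee_fin.
(* This is [ln (1 + x) <= x] at [x = b / a - 1]. *)
have ab : (ln b - ln a <= b / a - 1)%R.
  rewrite -ln_div//.
  have := @le_ln1Dx R (b / a - 1); rewrite addrCA subrr addr0; apply.
  by rewrite -subr_gt0 opprK subrK divr_gt0.
have {}ab : (a * (ln b - ln a) <= b - a)%R.
  rewrite (le_trans (ler_wpM2l (ltW a0) ab))// mulrBr mulr1 mulrCA.
  by rewrite divff ?gt_eqF// mulr1.
(* Once positive parts are eliminated, [a * u] and [a * v] occur on both sides and cancel. *)
have maxE (x : R) : (Num.max x 0%R = x + Num.max (- x) 0%R)%R.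
  case: (leP x 0%R) => x0; first by rewrite max_l ?oppr_ge0// subrr.
  by rewrite max_r ?addr0// oppr_le0 ltW.
rewrite (maxE (ln a)) (maxE (ln b)).
set u := Num.max _ _; set v := Num.max _ _; nra.
Qed.

(** The bounds by 1 make [u] and [v] finite, so they can be moved across even when [a] or [b] is
    infinite. *)
Lemma sube_le_sube_cancel (R : realType) (a b u v : \bar R) :
  0 <= a -> 0 <= b -> 0 <= u -> 0 <= v -> u <= 1 -> v <= 1 ->
  a + 1 + u <= b + 1 + v -> a - v <= b - u.
Proof.
move: a b u v => [a| |] [b| |] [u| |] [v| |] //=; rewrite ?leey//.
by rewrite -!EFinB -?EFinD !lee_fin => *; lra.
Qed.

(** * Integration against the output of a kernel *)

Section integral_kernel_output.
Context d d' (X : measurableType d) (Y : measurableType d') (R : realType).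
Variables (P : probability X R) (K : R.-pker X ~> Y).

(* A copy of [K x] that carries a canonical subprobability structure, as needed
   to view [K] as a map into the Giry monad. *)
Let Kg (x : X) : set Y -> \bar R := K x.

HB.instance Definition _ x := Measure.copy (Kg x) (K x).

Let KgT x : Kg x [set: Y] <= 1.
Proof. by rewrite /Kg prob_kernel. Qed.

HB.instance Definition _ x := Measure_isSubProbability.Build _ _ _ (Kg x) (KgT x).

(** On measurable sets the output measure is the Giry bind of [P] along [K], so the integration
    formula for bind applies. *)
Lemma integral_kernel_output (h : Y -> \bar R) :
    measurable_fun [set: Y] h -> (forall y, 0 <= h y) ->
  \int[kernel_output P K]_y h y = \int[P]_x \int[K x]_y h y.
Proof.
move=> mh h0.
pose f (x : X) : giry Y R := Kg x.
have mf : measurable_fun [set: X] f.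
  apply: measurable_giry_codensity => // B mB.
  exact: measurable_kernel.
transitivity (giry_int (giry_bind (P : giry X R) mf) h).
  apply: eq_measure_integral => A mA _.
  rewrite /giry_bind/= /giry_join/= giry_int_map//; exact: measurable_giry_ev.
by rewrite giry_int_bind.
Qed.

End integral_kernel_output.

(** * Densities and the two parts of the divergence *)

Section density.
Context d (T : measurableType d) (R : realType).
Variables (P Q : probability T R).
Hypothesis PQ : P `<< Q.

(** A version of the density that is nonnegative and finite at every point, so that
    [gibbs_pointwise] applies everywhere. *)
Local Notation f := (Radon_Nikodym_SigmaFinite.f P Q).

Lemma measurable_density : measurable_fun [set: T] f.
Proof. exact: measurable_int (Radon_Nikodym_SigmaFinite.f_integrable PQ). Qed.

Lemma integral_density : \int[Q]_x f x = 1.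
Proof.
by rewrite -Radon_Nikodym_SigmaFinite.f_integral//; exact: probability_setT.
Qed.

Lemma measurable_lne_density : measurable_fun [set: T] (@lne R \o f).
Proof. exact: measurableT_comp (@measurable_lne R) measurable_density. Qed.

Lemma measurable_funepos_lne_density :
  measurable_fun [set: T] (fun x => (@lne R)^\+ (f x)).
Proof.
apply: eq_measurable_fun (measurable_funepos measurable_lne_density) => x _.
by rewrite !funeposE.
Qed.

Lemma measurable_funeneg_lne_density :
  measurable_fun [set: T] (fun x => (@lne R)^\- (f x)).
Proof.
apply: eq_measurable_fun (measurable_funeneg measurable_lne_density) => x _.
by rewrite !funenegE.
Qed.

(** The derivative in the definition agrees with [f] [Q]-almost everywhere, hence [P]-almost
    everywhere by domination. *)
Lemma kl_divergence_density : kl_divergence P Q =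
  \int[P]_x (@lne R)^\+ (f x) - \int[P]_x (@lne R)^\- (f x).
Proof.
rewrite /kl_divergence asboolT//.
transitivity (\int[P]_x (@lne R \o f) x).
  apply: ae_eq_integral => //.
  - apply: measurableT_comp => //; first exact: measurable_lne.
  - exact: measurable_lne_density.
  - apply: ae_eq_comp; apply: ae_eq_sym.
    apply: (null_dominates_ae_eq _ PQ) => //.
    exact: ae_eq_Radon_Nikodym_SigmaFinite.
rewrite integralE; congr (_ - _); apply: eq_integral => x _.
  by rewrite !funeposE.
by rewrite !funenegE.
Qed.

(** As an integral against [Q], the integrand is [f] times the negative part of [lne f], which is at
    most 1 pointwise. *)
Lemma integral_funeneg_lne_density : \int[P]_x (@lne R)^\- (f x) <= 1.
Proof.
rewrite -(Radon_Nikodym_SigmaFinite.change_of_variables PQ)//; last first.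
  exact: measurable_funeneg_lne_density.
rewrite -[leRHS](_ : \int[Q]_x cst 1 x = 1); last first.
  by rewrite integral_cst// mul1e; exact: probability_setT.
apply: ge0_le_integral => //.
- move=> x _; rewrite mule_ge0//; exact: Radon_Nikodym_SigmaFinite.f_ge0.
- apply: emeasurable_funM; first exact: measurable_funeneg_lne_density.
  exact: measurable_density.
move=> x _ /=; have f0 := Radon_Nikodym_SigmaFinite.f_ge0 PQ x.
have := Radon_Nikodym_SigmaFinite.f_fin_num PQ x.
move: f0; case: (f x) => // r; rewrite lee_fin => r0 _; rewrite muleC.
have [r1|r1] := leP 1%R r.
  by rewrite funenegE max_r ?mule0// leeNl oppe0 lne_ge0 lee_fin.
(* For [r < 1], comparison with [b = 1] leaves [r] plus the wanted product on the left and 1 on the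
   right. *)
have := @gibbs_pointwise R r%:E 1 isT isT r0 lee01.
have -> : (@lne R)^\+ r%:E = 0.
  by rewrite funeposE max_r// lne_le0 lee_fin ltW.
have -> : (@lne R)^\+ 1 = 0 by rewrite funeposE lne1 maxxx.
have -> : (@lne R)^\- 1 = 0 by rewrite funenegE lne1 oppe0 maxxx.
rewrite !mule0 add0e !adde0 add0e; apply: le_trans.
by rewrite leeDr// lee_fin.
Qed.

End density.

(** * Composition of kernels and data processing *)

Lemma kernel_output_mkcomp_noparam d0 d1 d2 (X : measurableType d0)
    (Y : measurableType d1) (Z : measurableType d2) (R : realType)
    (P : probability X R) (K : R.-pker X ~> Y) (L : R.-pker Y ~> Z) A :
  measurable A ->
  kernel_output P (mkcomp_noparam K L) A = kernel_output (kernel_output P K) L A.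
Proof.
move=> mA; rewrite [RHS]/kernel_output integral_kernel_output//.
exact: measurable_kernel.
Qed.

(* [P'] and [Q'] are only required to agree with the outputs of [K] on
   measurable sets: this covers the two ways of bracketing a composition, which
   as set functions may differ on non-measurable sets. *)
Lemma null_dominates_kernel_output d d' (X : measurableType d)
    (Y : measurableType d') (R : realType) (P Q : probability X R)
    (K : R.-pker X ~> Y) (P' Q' : probability Y R) :
  (forall A, measurable A -> P' A = kernel_output P K A) ->
  (forall A, measurable A -> Q' A = kernel_output Q K A) ->
  P `<< Q -> P' `<< Q'.
Proof.
move=> PE QE PQ A nA.
(* Nullity of [A] is tested on its measurable subsets. *)
suff h : forall B, measurable B -> kernel_output Q K B = 0 ->
    kernel_output P K B = 0.
  by move=> B mB BA; rewrite PE// h// -QE//; exact: nA.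
move=> B mB; rewrite /kernel_output => QB.
have mK : measurable_fun [set: X] (K ^~ B) by exact: measurable_kernel.
(* A nonnegative function with zero integral vanishes almost everywhere, a property that passes from
   [Q] to [P]. *)
have : ae_eq Q setT (K ^~ B) (cst 0).
  apply/ae_eq_integral_abs => //.
  by rewrite -[RHS]QB; apply: eq_integral => x _; rewrite gee0_abs.
move=> /(null_dominates_ae_eq measurableT PQ) /ae_eq_integral_abs.
move=> /(_ measurableT mK) h; rewrite -[RHS]h.
by apply: eq_integral => x _; rewrite gee0_abs.
Qed.

Lemma kl_divergence_kernel_output d d' (X : measurableType d)
    (Y : measurableType d') (R : realType) (P Q : probability X R)
    (K : R.-pker X ~> Y) (P' Q' : probability Y R) :
  (forall A, measurable A -> P' A = kernel_output P K A) ->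
  (forall A, measurable A -> Q' A = kernel_output Q K A) ->
  kl_divergence P' Q' <= kl_divergence P Q.
Proof.
move=> PE QE.
have [PQ|nPQ] := pselect (P `<< Q); last first.
  by rewrite [leRHS]/kl_divergence asboolF// leey.
have PQ' : P' `<< Q' by exact: null_dominates_kernel_output PE QE PQ.
rewrite !kl_divergence_density//.
pose f := Radon_Nikodym_SigmaFinite.f P Q.
pose g := Radon_Nikodym_SigmaFinite.f P' Q'.
have f0 x : 0 <= f x by exact: Radon_Nikodym_SigmaFinite.f_ge0.
have g0 y : 0 <= g y by exact: Radon_Nikodym_SigmaFinite.f_ge0.
have ffin x : f x \is a fin_num by exact: Radon_Nikodym_SigmaFinite.f_fin_num.
have gfin y : g y \is a fin_num by exact: Radon_Nikodym_SigmaFinite.f_fin_num.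
have mf : measurable_fun setT f by exact: measurable_density.
have mg : measurable_fun setT g by exact: measurable_density.
have mfp := measurable_funepos_lne_density PQ; rewrite -/f in mfp.
have mfn := measurable_funeneg_lne_density PQ; rewrite -/f in mfn.
have mgp := measurable_funepos_lne_density PQ'; rewrite -/g in mgp.
have mgn := measurable_funeneg_lne_density PQ'; rewrite -/g in mgn.
have mK (h : Y -> \bar R) : measurable_fun setT h -> (forall y, 0 <= h y) ->
    measurable_fun setT (fun x => \int[K x]_y h y).
  move=> mh h0; apply: measurable_fun_integral_kernel => // U mU.
  exact: measurable_kernel.
have cov (h : X -> \bar R) : measurable_fun setT h -> (forall y, 0 <= h y) ->
    \int[Q]_x (f x * h x) = \int[P]_x h x.
  move=> mh h0; rewrite -(Radon_Nikodym_SigmaFinite.change_of_variables PQ)//.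
  by apply: eq_integral => x _; rewrite muleC.
rewrite -/f -/g.
have Kint (h : Y -> \bar R) x : (forall y, 0 <= h y) -> 0 <= \int[K x]_y h y.
  by move=> h0; exact: integral_ge0.
(* [gibbs_pointwise] at [f x] and [g y], integrated in [y] against [K x]; terms free of [y] are
   unchanged since [K x] has mass 1. *)
have key x : f x * \int[K x]_y (@lne R)^\+ (g y) + f x + f x * (@lne R)^\- (f x)
    <= f x * (@lne R)^\+ (f x) + \int[K x]_y g y +
       f x * \int[K x]_y (@lne R)^\- (g y).
  have cstK (r : \bar R) : 0 <= r -> \int[K x]_y r = r.
    by move=> r0; rewrite (integral_cst (K x))// prob_kernel mule1.
  have -> : f x * \int[K x]_y (@lne R)^\+ (g y) + f x + f x * (@lne R)^\- (f x) =
    \int[K x]_y (f x * (@lne R)^\+ (g y) + f x + f x * (@lne R)^\- (f x)).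
    rewrite ge0_integralD//; last 3 first.
    - by move=> y _; rewrite adde_ge0 ?mule_ge0.
    - by apply: emeasurable_funD => //; exact: measurable_funeM.
    - by move=> y _; rewrite mule_ge0.
    rewrite ge0_integralD//; last 2 first.
    - by move=> y _; rewrite mule_ge0.
    - exact: measurable_funeM.
    by rewrite ge0_integralZl// !cstK// mule_ge0.
  have -> : f x * (@lne R)^\+ (f x) + \int[K x]_y g y +
       f x * \int[K x]_y (@lne R)^\- (g y) =
    \int[K x]_y (f x * (@lne R)^\+ (f x) + g y + f x * (@lne R)^\- (g y)).
    rewrite ge0_integralD//; last 4 first.
    - by move=> y _; rewrite adde_ge0 ?mule_ge0.
    - exact: emeasurable_funD.
    - by move=> y _; rewrite mule_ge0.
    - exact: measurable_funeM.
    rewrite ge0_integralD//; last by move=> y _; rewrite mule_ge0.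
    by rewrite cstK ?mule_ge0// ge0_integralZl//.
  apply: ge0_le_integral => //.
  - by move=> y _; rewrite !adde_ge0 ?mule_ge0.
  - by repeat apply: emeasurable_funD => //; exact: measurable_funeM.
  - by repeat apply: emeasurable_funD => //; exact: measurable_funeM.
  - by move=> y _; exact: gibbs_pointwise.
have mKgp := mK _ mgp (fun y => funepos_ge0 (@lne R) (g y)).
have mKgn := mK _ mgn (fun y => funeneg_ge0 (@lne R) (g y)).
have mKg := mK _ mg g0.
have KP (h : Y -> \bar R) : measurable_fun setT h -> (forall y, 0 <= h y) ->
    \int[P']_y h y = \int[P]_x \int[K x]_y h y.
  move=> mh h0; rewrite -integral_kernel_output//.
  by apply: eq_measure_integral => A mA _; exact: PE.
have KQ (h : Y -> \bar R) : measurable_fun setT h -> (forall y, 0 <= h y) ->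
    \int[Q']_y h y = \int[Q]_x \int[K x]_y h y.
  move=> mh h0; rewrite -integral_kernel_output//.
  by apply: eq_measure_integral => A mA _; exact: QE.
(* This is [key] integrated against [Q], with [f] absorbed into [P] by [cov]. *)
have : \int[P']_y (@lne R)^\+ (g y) + 1 +
    \int[P]_x (@lne R)^\- (f x) <=
    \int[P]_x (@lne R)^\+ (f x) + 1 +
    \int[P']_y (@lne R)^\- (g y).
  rewrite !KP// -!cov//; [|by move=> x; exact: Kint..].
  (* The left 1 is the [Q]-integral of [f], the right 1 the [Q']-integral of [g]. *)
  rewrite -[X in _ + X + _ <= _](integral_density PQ).
  rewrite -[X in _ <= _ + X + _](integral_density PQ') KQ// -/f -/g.
  have mM (h : X -> \bar R) : measurable_fun setT h ->
    measurable_fun setT (fun x => f x * h x).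
    by move=> mh; exact: emeasurable_funM.
  have mL : measurable_fun setT (fun x =>
      f x * \int[K x]_y (@lne R)^\+ (g y) + f x).
    by apply: emeasurable_funD => //; exact: mM.
  have mR : measurable_fun setT (fun x =>
      f x * (@lne R)^\+ (f x) + \int[K x]_y g y).
    by apply: emeasurable_funD => //; exact: mM.
  have fM_ge0 (h : X -> \bar R) : (forall x, 0 <= h x) ->
    forall x, [set: X] x -> 0 <= f x * h x.
    by move=> h0 x _; exact: mule_ge0.
  have mp := mM _ mKgp; have mn := mM _ mKgn.
  have mfpM := mM _ mfp; have mfnM := mM _ mfn.
  have p0 := fM_ge0 _ (fun x => Kint _ x (fun y => funepos_ge0 (@lne R) (g y))).
  have n0 := fM_ge0 _ (fun x => Kint _ x (fun y => funeneg_ge0 (@lne R) (g y))).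
  have fp0 := fM_ge0 _ (fun x => funepos_ge0 (@lne R) (f x)).
  have fn0 := fM_ge0 _ (fun x => funeneg_ge0 (@lne R) (f x)).
  have Kg0 x : [set: X] x -> 0 <= \int[K x]_y g y by move=> _; exact: Kint.
  rewrite -!ge0_integralD//.
  all: try by move=> x _; rewrite adde_ge0 ?p0 ?fp0 ?Kg0.
  apply: ge0_le_integral => //.
  - by move=> x _; rewrite !adde_ge0 ?mule_ge0 ?Kint.
  - by apply: emeasurable_funD => //; exact: mM.
  - by apply: emeasurable_funD => //; exact: mM.
have := integral_funeneg_lne_density PQ.
have := integral_funeneg_lne_density PQ'.
rewrite -/f -/g.
have Ifp : 0 <= \int[P]_x (@lne R)^\+ (f x) by exact: integral_ge0.
have Ifn : 0 <= \int[P]_x (@lne R)^\- (f x) by exact: integral_ge0.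
have Igp : 0 <= \int[P']_x (@lne R)^\+ (g x).
  exact: integral_ge0.
have Ign : 0 <= \int[P']_x (@lne R)^\- (g x).
  exact: integral_ge0.
move=> gn1 fn1 le1.
exact: sube_le_sube_cancel.
Qed.

Theorem mainTheorem8 (R : realType) (dX : measure_display)
  (X : measurableType dX) (QX : probability X R) (m : nat)
  (dY : 'I_m -> measure_display) (Y : forall j : 'I_m, measurableType (dY j))
  (QYX : forall j : 'I_m, R.-pker X ~> Y j)
  (c : 'I_m -> R) (c_gt0 : forall j : 'I_m, (0 < c j)%R) (d : R)
  (hY : forall PX : probability X R, PX `<< QX ->
     kl_divergence PX QX + d%:E >=
     \sum_(j < m) (c j)%:E *
       kl_divergence (kernel_output PX (QYX j)) (kernel_output QX (QYX j)))
  (dZ : 'I_m -> measure_display) (Z : forall j : 'I_m, measurableType (dZ j))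
  (QZY : forall j : 'I_m, R.-pker Y j ~> Z j)
  (PX : probability X R) :
  PX `<< QX ->
  kl_divergence PX QX + d%:E >=
  \sum_(j < m) (c j)%:E *
    kl_divergence (kernel_output PX (mkcomp_noparam (QYX j) (QZY j)))
                  (kernel_output QX (mkcomp_noparam (QYX j) (QZY j))).
Proof.
(* The hypothesis at [PX] bounds the sum over the [Y j]; passing to the [Z j] can only decrease each
   term. *)
move=> PQ; apply: le_trans (hY PX PQ); apply: lee_sum => j _.
apply: lee_wpmul2l; first by rewrite lee_fin ltW.
(* The intermediate laws are the outputs on [Y j], and [QZY j] is the kernel applied to them. *)
apply: kl_divergence_kernel_output => A mA;
exact: kernel_output_mkcomp_noparam.
Qed.
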